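(* Let $P:\mathbb{R}^n\to\mathbb{R}$ be a homogeneous real polynomial of degree $k$ that is symmetric and hyperbolic with respect to $\mathbf{1}=(1,\dots,1)$, with hyperbolicity cone $\Gamma(P)$ with respect to $\mathbf{1}$. Let $A$ be an $n\times n$ real symmetric matrix with $\lambda(A)\in\Gamma(P)$. Then: (i) $\operatorname{diag}(A)\in\Gamma(P)$; (ii) $P(\operatorname{diag}(A))\ge P(\lambda(A))$.
   Context: For a real symmetric matrix $A=(a_{ij})$ of size $n$, $\lambda(A)=(\lambda_1(A),\dots,\lambda_n(A))$ is the list of its eigenvalues (with multiplicity; the order is immaterial because $P$ is symmetric), and $\operatorname{diag}(A)=(a_{11},\dots,a_{nn})\in\mathbb{R}^n$ is the vector of its diagonal entries. A polynomial $P:\mathbb{R}^n\to\mathbb{R}$ is symmetric if $P(\sigma x)=P(x)$ for every permutation $\sigma$ of the coordinates and every $x\in\mathbb{R}^n$. A homogeneous real polynomial $P$ of degree $k$ on $\mathbb{R}^n$ is hyperbolic with respect to $a\in\mathbb{R}^n$ if $P(a)>0$ and, for every $x\in\mathbb{R}^n$, the univariate polynomial $t\mapsto P(ta+x)$ has only real zeros. In that case $P(ta+x)=P(a)\prod_{i=1}^k(t+\lambda_i(P;a,x))$ with real numbers $\lambda_i(P;a,x)$, called the $a$-eigenvalues of $x$. The hyperbolicity cone is $\Gamma(P;a)=\{x\in\mathbb{R}^n:\lambda_i(P;a,x)>0\text{ for all }i=1,\dots,k\}$, and $\Gamma(P):=\Gamma(P;\mathbf{1})$. *)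

(* Defs.v *)
From mathcomp Require Export all_boot all_order all_algebra all_fingroup.
From mathcomp Require Export reals complex mpoly.

Set Implicit Arguments.
Unset Strict Implicit.
Unset Printing Implicit Defensive.

Import Order.TTheory GRing.Theory Num.Theory.

Local Open Scope ring_scope.

(* A point of R^n is a function 'I_n -> R, the type of points at which
   multinomials evaluates polynomials. *)

Definition symmetric_poly (R : realType) (n : nat) (P : {mpoly R[n]}) : Prop :=
  forall (s : 'S_n) (x : 'I_n -> R), P.@[fun i => x (s i)] = P.@[x].

(* The univariate polynomial P(t a + x) in t. *)
Definition line_poly (R : realType) (n : nat) (P : {mpoly R[n]})
    (a x : 'I_n -> R) : {poly R} :=
  mmap (@polyC R) (fun i => a i *: 'X + (x i)%:P) P.

Lemma horner_line_poly (R : realType) (n : nat) (P : {mpoly R[n]})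
    (a x : 'I_n -> R) (t : R) :
  (line_poly P a x).[t] = P.@[fun i => t * a i + x i].
Proof.
rewrite /line_poly /meval /mmap horner_sum; apply: eq_bigr => m _.
rewrite hornerM hornerC /mmap1 horner_prod; congr (_ * _).
by apply: eq_bigr => i _; rewrite horner_exp !hornerE mulrC.
Qed.

(* "Only real zeros" means that every zero in R[i] is real. *)
Definition hyperbolic (R : realType) (n : nat) (P : {mpoly R[n]})
    (a : 'I_n -> R) : Prop :=
  0 < P.@[a] /\
  forall (x : 'I_n -> R) (z : R[i]),
    root (map_poly (real_complex R) (line_poly P a x)) z -> z \is Num.real.

(* The values l_i are the a-eigenvalues of x, listed with multiplicity: they
   are the opposites of the roots of P(t a + x). *)
Definition hyp_eigenvalues (R : realType) (n k : nat) (P : {mpoly R[n]})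
    (a x : 'I_n -> R) (l : 'I_k -> R) : Prop :=
  line_poly P a x = P.@[a] *: \prod_(i < k) ('X + (l i)%:P).

(* For P homogeneous of degree k and hyperbolic with respect to a, the
   a-eigenvalues of x exist and are unique up to order, so the choice of the
   enumeration l is immaterial. *)
Definition hyp_cone (R : realType) (n k : nat) (P : {mpoly R[n]})
    (a : 'I_n -> R) (x : 'I_n -> R) : Prop :=
  exists2 l : 'I_k -> R, hyp_eigenvalues P a x l & forall i, 0 < l i.

Definition ones (R : realType) (n : nat) : 'I_n -> R := fun=> 1.

Definition diag_vec (R : realType) (n : nat) (A : 'M[R]_n) : 'I_n -> R :=
  fun i => A i i.

(* l enumerates the eigenvalues of A with (algebraic) multiplicity. *)
Definition eigenvalue_list (R : realType) (n : nat) (A : 'M[R]_n)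
    (l : 'I_n -> R) : Prop :=
  char_poly A = \prod_(i < n) ('X - (l i)%:P).

(* Main.v *)
Require Import Defs.
From mathcomp Require Import spectral sesquilinear.
From mathcomp Require boolp classical_sets.
From mathcomp Require Import ring lra zify.

Set Implicit Arguments.
Unset Strict Implicit.
Unset Printing Implicit Defensive.

Import Order.TTheory GRing.Theory Num.Theory.
Import Normc.
Local Open Scope ring_scope.

(** The diagonal of A is the image of its vector of eigenvalues lambda under
    the doubly stochastic matrix of the squared moduli of the entries of a
    unitary matrix that diagonalizes A ([symmetric_diag_weights]).  By Birkhoff,
    it is a convex combination of rearrangements of lambda
    ([birkhoff_convex]).  All of these lie in the cone and have the same value
    P lambda, because P and the vector of ones are invariant under
    permutations.  So both claims follow once the set of the points of the
    cone at which P is at least a given value is known to be convex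
    ([hyp_cone_convex]).

    The convexity is due to Garding.  P is also hyperbolic with respect to each
    point x of its cone ([hyperbolic_change_direction]), and every other point y
    of the cone has positive eigenvalues m i with respect to x
    ([hyp_cone_change_direction]).  Then P ((1 - s) x + s y) equals
    P x * \prod_i (1 - s + s * m i), which is positive and at least the
    smaller of P x and P y = P x * \prod_i m i.

    Both facts about the change of direction come from one continuity principle
    ([no_upper_zero_deformation]): if a family of polynomials of fixed degree
    and fixed leading coefficient never vanishes on the real axis, then its
    roots stay on the side of the axis where they start.  The principle rests
    on factorizations into linear factors and on a Lipschitz bound in the
    parameter that is uniform relative to (1 + |z|) ^ k
    ([ceval_lipschitz]). *)

(** * Doubly stochastic matrices and averages *)

(** Marriage theorem, by the argument of Halmos and Vaughan: induct on the
    number of indices.  If a proper nonempty set J is critical (it sees exactly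
    #|J| values), match J first and the rest outside these values; otherwise
    every proper subset has a spare value and any first choice can be made. *)
Lemma hall_marriage (T : finType) (N : T -> {set T}) (D : {set T}) :
    (forall J : {set T}, J \subset D -> (#|J| <= #|\bigcup_(i in J) N i|)%N) ->
  exists2 f : T -> T, {in D &, injective f} & {in D, forall i, f i \in N i}.
Proof.
have [m] := ubnP #|D|; elim: m => // m IHm in N D *.
rewrite ltnS => leDm hallD.
have [->|[i0 Di0]] := set_0Vmem D.
  by exists id => [i j|i]; rewrite inE.
have [/existsP[J /and4P[sJD nJD J0 /eqP critJ]]|noncrit] :=
  boolP [exists J : {set T}, [&& J \subset D, J != D, J != set0
                      & #|\bigcup_(i in J) N i| == #|J|]].
  (* Critical case: J uses up all its neighbours NJ, so the other indices are
     matched outside NJ; Hall's condition there is that of K :|: J minus J. *)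
  set NJ := \bigcup_(i in J) N i in critJ.
  have ltJD : (#|J| < #|D|)%N by rewrite proper_card // properEneq nJD.
  have [||f finj fN] := IHm N J; first exact: leq_trans leDm.
    by move=> K sKJ; apply: hallD; apply: subset_trans sJD.
  have [||g ginj gN] := IHm (fun i => N i :\: NJ) (D :\: J).
  - apply: leq_trans leDm; rewrite cardsD (setIidPr sJD).
    by rewrite ltn_subrL !card_gt0 J0 /=; apply/set0Pn; exists i0.
  - move=> K sKDJ; have dKJ : [disjoint K & J].
      rewrite disjoint_subset; apply/subsetP => i /(subsetP sKDJ).
      by rewrite !inE => /andP[].
    have := hallD (K :|: J); rewrite subUset sJD andbT.
    rewrite (subset_trans sKDJ (subsetDl _ _)) => /(_ isT).
    rewrite cardsU (disjoint_setI0 dKJ) cards0 subn0 bigcup_setU -/NJ => hallKJ.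
    rewrite -(leq_add2r #|J|) (leq_trans hallKJ) // -critJ.
    apply: leq_trans (leq_card_setU _ _).1; apply/subset_leq_card.
    apply/subsetP => j; rewrite !inE => /orP[/bigcupP[i Ki Nij]|->]; last first.
      by rewrite orbT.
    have [//|NJj] := boolP (j \in NJ); first by rewrite orbT.
    by rewrite orbF; apply/bigcupP; exists i; rewrite // inE NJj.
  have fNJ i : i \in J -> f i \in NJ.
    by move=> Ji; apply/bigcupP; exists i; rewrite ?fN.
  exists (fun i => if i \in J then f i else g i).
    move=> i j Di Dj /=.
    have gNJ l : l \in D -> l \notin J -> g l \notin NJ.
      by move=> Dl Jl; have := gN l; rewrite !inE Jl Dl => /(_ isT)/andP[].
    case: (boolP (i \in J)) => Ji; case: (boolP (j \in J)) => Jj.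
    - exact: finj.
    - by move=> fij; have := gNJ _ Dj Jj; rewrite -fij fNJ.
    - by move=> fij; have := gNJ _ Di Ji; rewrite fij fNJ.
    - by apply: ginj; rewrite inE ?Ji ?Jj.
  move=> i Di /=; case: (boolP (i \in J)) => Ji; first exact: fN.
  by have := gN i; rewrite !inE Ji Di => /(_ isT)/andP[].
(* No critical set: match i0 with an arbitrary neighbour j0; removing j0
   costs each set at most one neighbour, which the strict inequality affords. *)
have /card_gt0P[j0 Nij0] : (0 < #|N i0|)%N.
  by have := hallD [set i0]; rewrite sub1set cards1 big_set1 => /(_ Di0).
have [||f finj fN] := IHm (fun i => N i :\ j0) (D :\ i0).
- by move: leDm; rewrite (cardsD1 i0 D) Di0.
- move=> J sJ; have [->|J0] := eqVneq J set0; first by rewrite cards0.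
  have sJD : J \subset D by apply: subset_trans sJ (subsetDl _ _).
  have nJD : J != D.
    apply: contraTneq Di0 => <-; apply/negP => /(subsetP sJ).
    by rewrite !inE eqxx.
  have ltJ : (#|J| < #|\bigcup_(i in J) N i|)%N.
    rewrite ltn_neqAle hallD // andbT eq_sym; apply: contra noncrit => critJ.
    by apply/existsP; exists J; rewrite sJD nJD J0.
  rewrite -ltnS (leq_trans ltJ) // -[leqRHS]add1n.
  rewrite -(cards1 j0); apply: leq_trans (leq_card_setU _ _).1.
  apply/subset_leq_card/subsetP => j /bigcupP[i Ji Nij]; rewrite !inE.
  have [//|nj] := eqVneq j j0.
  by apply/bigcupP; exists i; rewrite // !inE nj.
have fj0 i : i \in D -> i != i0 -> f i != j0.
  by move=> Di ni; have := fN i; rewrite !inE ni Di => /(_ isT)/andP[].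
exists (fun i => if i == i0 then j0 else f i).
  move=> i j Di Dj /=; have [->|ni] := eqVneq i i0.
    have [->//|nj] := eqVneq j i0.
    by move=> /esym/eqP fj; have := fj0 _ Dj nj; rewrite fj.
  have [->|nj] := eqVneq j i0; last by apply: finj; rewrite !inE ?ni ?nj.
  by move=> /eqP fi; have := fj0 _ Di ni; rewrite fi.
move=> i Di /=; have [->//|ni] := eqVneq i i0.
by have := fN i; rewrite !inE ni Di => /(_ isT)/andP[].
Qed.

(** Hall's condition for the supports of the rows holds by double counting:
    the rows in J carry the mass s * #|J|, all of it inside the columns seen by
    J, whose total mass is s times their number. *)
Lemma positive_transversal (F : realFieldType) (T : finType) (S : T -> T -> F)
    (s : F) :
    0 < s -> (forall i j, 0 <= S i j) ->
    (forall i, \sum_j S i j = s) -> (forall j, \sum_i S i j = s) ->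
  exists sigma : {perm T}, forall i, 0 < S i (sigma i).
Proof.
move=> s_gt0 S_ge0 Srow Scol.
have [J _|f finj fS] := @hall_marriage T (fun i => [set j | S i j != 0]) setT.
  set NJ := \bigcup_(i in J) _.
  rewrite -(ler_nat F) -(ler_pM2l s_gt0) !mulr_natr -!sumr_const.
  have -> : \sum_(i in J) s = \sum_(i in J) \sum_(j in NJ) S i j.
    apply: eq_bigr => i Ji; rewrite -(Srow i) (bigID (mem NJ)) /=.
    rewrite [X in _ + X]big1 ?addr0 // => j; apply: contraNeq => Sij.
    by apply/bigcupP; exists i; rewrite // inE.
  rewrite exchange_big /=; apply: ler_sum => j _; rewrite -(Scol j).
  by rewrite [leRHS](bigID (mem J)) /= lerDl sumr_ge0.
have finj' : injective f by move=> i j; apply: finj; rewrite inE.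
exists (perm finj') => i; rewrite permE lt0r S_ge0 andbT.
by have := fS i; rewrite !inE => /(_ isT).
Qed.

(** The content of Birkhoff's theorem in the form used below: a convex set
    that contains every rearrangement of x contains S x for each doubly
    stochastic S.  Allowing an arbitrary common row and column sum s keeps the
    class of matrices stable under peeling off a multiple c of a permutation
    matrix, where c is the least entry on a positive transversal; each such
    step kills an entry of S. *)
Lemma birkhoff_convex (F : realFieldType) (T : finType) (C : (T -> F) -> Prop)
    (x : T -> F) (S : T -> T -> F) (s : F) :
    (forall y z, y =1 z -> C y -> C z) ->
    (forall y z t, C y -> C z -> 0 <= t <= 1 ->
      C (fun i => (1 - t) * y i + t * z i)) ->
    (forall sigma : {perm T}, C (fun i => x (sigma i))) ->
    0 < s -> (forall i j, 0 <= S i j) ->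
    (forall i, \sum_j S i j = s) -> (forall j, \sum_i S i j = s) ->
  C (fun i => s^-1 * \sum_j S i j * x j).
Proof.
move=> Cext Cconv Cperm.
have [m] := ubnP #|[set ij : T * T | S ij.1 ij.2 != 0]|.
elim: m => // m IHm in S s *; rewrite ltnS => leSm s_gt0 S_ge0 Srow Scol.
have [sigma Sgt0] := positive_transversal s_gt0 S_ge0 Srow Scol.
pose D i j : F := (j == sigma i)%:R.
have Dsum (y : T -> F) i : \sum_j D i j * y j = y (sigma i).
  rewrite (bigD1 (sigma i)) //= /D eqxx mul1r big1 ?addr0 // => j nj.
  by rewrite (negPf nj) mul0r.
have Drow i : \sum_j D i j = 1.
  by rewrite -[RHS](Dsum (fun=> 1) i); apply: eq_bigr => j _; rewrite mulr1.
have Dcol j : \sum_i D i j = 1.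
  rewrite (bigD1 (sigma^-1%g j)) //= /D permKV eqxx big1 ?addr0 // => i ni.
  by case: eqP => // jE; rewrite jE permK eqxx in ni.
have [/forallP Sge|] := boolP [forall i, s <= S i (sigma i)].
  (* The transversal carries all the mass of each row, so S is s times a
     permutation matrix. *)
  apply: Cext (Cperm sigma) => i /=.
  have SE j : S i j = s * D i j.
    have Sdom : \sum_(j | j != sigma i) S i j <= 0.
      have := Srow i; rewrite (bigD1 (sigma i)) //=; have := Sge i; lra.
    have [->|nj] := eqVneq j (sigma i).
      rewrite /D eqxx mulr1; apply/le_anti; rewrite Sge andbT.
      by rewrite -(Srow i) (bigD1 (sigma i)) //= lerDl sumr_ge0.
    rewrite /D (negPf nj) mulr0; apply/le_anti; rewrite S_ge0 andbT.
    by apply: le_trans Sdom; rewrite (bigD1 j) //= lerDl sumr_ge0.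
  rewrite (eq_bigr (fun j => s * (D i j * x j))) => [|j _]; last first.
    by rewrite SE mulrA.
  by rewrite -mulr_sumr Dsum mulKf ?gt_eqF.
case/forallPn => i1; rewrite -ltNge => lt_i1.
have [i0 min_i0] : exists i0, forall i, S i0 (sigma i0) <= S i (sigma i).
  case: (arg_minP (fun i => S i (sigma i)) (erefl : xpredT i1)) => i0 _ h.
  by exists i0 => i; apply: h.
set c := S i0 (sigma i0).
have c_lts : c < s by apply: le_lt_trans (min_i0 _) lt_i1.
have c_gt0 : 0 < c by apply: Sgt0.
have s_neq0 : s != 0 by rewrite gt_eqF.
have sc_neq0 : s - c != 0 by lra.
pose S' i j := S i j - c * D i j.
have S'_ge0 i j : 0 <= S' i j.
  rewrite /S' /D; case: eqP => [->|_]; last by rewrite mulr0 subr0.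
  by rewrite mulr1 subr_ge0.
have CS' : C (fun i => (s - c)^-1 * \sum_j S' i j * x j).
  apply: IHm => //; last 3 first.
  - by rewrite subr_gt0.
  - by move=> i; rewrite big_split sumrN -mulr_sumr Srow Drow mulr1.
  - by move=> j; rewrite big_split sumrN -mulr_sumr Scol Dcol mulr1.
  apply: leq_trans leSm; apply/proper_card/properP; split.
    apply/subsetP => -[i j]; rewrite !inE /S' /=; apply: contraNneq => Sij.
    have := S'_ge0 i j; rewrite /S' Sij sub0r oppr_ge0 /D.
    case: (j == _); last by rewrite mulr0 oppr0.
    by rewrite mulr1; have := c_gt0; lra.
  exists (i0, sigma i0); rewrite !inE /=; first by rewrite gt_eqF.
  by rewrite /S' /D eqxx mulr1 subrr eqxx.
have t01 : 0 <= (s - c) / s <= 1.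
  rewrite ler_pdivrMr // mul1r divr_ge0 /=; lra.
apply: Cext (Cconv _ _ _ (Cperm sigma) CS' t01) => i /=.
rewrite /S'; under eq_bigr => j _ do rewrite mulrBl -mulrA.
rewrite big_split /= sumrN -mulr_sumr Dsum.
by field; rewrite s_neq0 sc_neq0.
Qed.

(** Along the segment from 1 to mu the product of the entries stays above the
    smaller of its end values.  If all entries lie on the same side of 1 this
    holds factor by factor.  Otherwise a factor a < 1 and a factor b > 1 can be
    merged into a * b, since
    (1 - s + s a) (1 - s + s b) - (1 - s + s a b)
    = s (1 - s) (1 - a) (b - 1). *)
Lemma min_prod_le_prod_mix (F : realFieldType) (s : F) (l : seq F) :
    0 <= s <= 1 -> {in l, forall mu, 0 < mu} ->
  Num.min 1 (\prod_(mu <- l) mu) <= \prod_(mu <- l) (1 - s + s * mu).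
Proof.
move=> /andP[s_ge0 s_le1]; have [m] := ubnP (size l).
elim: m => // m IHm in l *; rewrite ltnS => lem l_gt0.
have [/allP l_ge1|/allPn[a la]] := boolP (all (fun mu => 1 <= mu) l).
  rewrite ge_min; apply/orP; left; rewrite big_seq.
  apply: (big_ind (fun u => 1 <= u)) => // [u v|mu /l_ge1]; last first.
    by clear -s_ge0; nra.
  exact: mulr_ege1.
rewrite -ltNge => a_lt1.
have [/allP l_le1|/allPn[b lb]] := boolP (all (fun mu => mu <= 1) l).
  rewrite ge_min; apply/orP; right; rewrite !big_seq; apply: ler_prod => mu lmu.
  rewrite ltW ?l_gt0 //= -subr_ge0.
  have -> : 1 - s + s * mu - mu = (1 - s) * (1 - mu) by ring.
  by apply: mulr_ge0; rewrite subr_ge0 //; exact: (l_le1 _ lmu).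
rewrite -ltNge => b_gt1.
have lb' : b \in rem a l.
  have : b \in a :: rem a l by rewrite -(perm_mem (perm_to_rem la)).
  by rewrite inE gt_eqF // (lt_trans a_lt1).
have pl : perm_eq l [:: a, b & rem b (rem a l)].
  by rewrite (perm_trans (perm_to_rem la)) // perm_cons perm_to_rem.
set l' := rem b (rem a l) in pl.
have a_gt0 := l_gt0 _ la; have b_gt0 := l_gt0 _ lb.
have l'_gt0 : {in l', forall mu, 0 < mu}.
  by move=> mu l'mu; apply: l_gt0; rewrite (perm_mem pl) !inE l'mu !orbT.
rewrite !(perm_big _ pl) /= !big_cons.
have := IHm (a * b :: l'); rewrite !big_cons -mulrA.
have <- : (size l).-1 = (size (a * b :: l')) by rewrite (perm_size pl).
rewrite (perm_size pl) /= => /(_ _ _)/le_trans; apply.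
- by move: lem; rewrite (perm_size pl).
- by move=> mu; rewrite inE => /predU1P[->|/l'_gt0//]; rewrite mulr_gt0.
rewrite mulrA ler_wpM2r //.
  by rewrite big_seq; apply: prodr_ge0 => mu /l'_gt0; nra.
rewrite -subr_ge0; set d := _ - _.
have -> : d = s * (1 - s) * ((1 - a) * (b - 1)) by rewrite /d; ring.
by rewrite !mulr_ge0 ?subr_ge0 // ltW.
Qed.

Local Open Scope complex_scope.
Local Notation Im := complex.Im.
Local Notation Re := complex.Re.

(** * Restriction of a form to complex lines *)

Section LinePolynomials.
Variables (R : realType) (n k : nat) (P : {mpoly R[n]}).
Hypothesis P_homog : P \is k.-homog.

(** The polynomial P (t b + x) in t after extension of the scalars along f, so
    that b and x may have complex coordinates. *)
Definition ext_line_poly (K : comNzRingType) (f : {rmorphism R -> K})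
    (b x : 'I_n -> K) : {poly K} :=
  mmap (polyC \o f) (fun i => b i *: 'X + (x i)%:P) P.

Lemma horner_ext_line_poly (K : comNzRingType) (f : {rmorphism R -> K})
    (b x : 'I_n -> K) (t : K) :
  (ext_line_poly f b x).[t] = mmap f (fun i => t * b i + x i) P.
Proof.
rewrite /ext_line_poly /mmap horner_sum; apply: eq_bigr => m _.
rewrite hornerM hornerC /mmap1 horner_prod; congr (_ * _).
by apply: eq_bigr => i _; rewrite horner_exp !hornerE mulrC.
Qed.

(** Each monomial of P contributes a product of k linear factors b_i t + x_i,
    hence a polynomial of degree at most k with leading term that of P at b. *)
Lemma size_coef_ext_line_poly (K : comNzRingType) (f : {rmorphism R -> K})
    (b x : 'I_n -> K) :
  (size (ext_line_poly f b x) <= k.+1)%N /\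
  (ext_line_poly f b x)`_k = mmap f b P.
Proof.
pose top (p : {poly K}) d c := (size p <= d.+1)%N /\ p`_d = c.
have topC c : top c%:P 0%N c by split; rewrite ?size_polyC_leq1 ?coefC.
have topM p q d e u v : top p d u -> top q e v -> top (p * q) (d + e)%N (u * v).
  move=> [sp pd] [sq qe]; split.
    by apply: leq_trans (size_polyMleq _ _) _; lia.
  have ltd : (d < (d + e).+1)%N by lia.
  rewrite coefM (bigD1 (Ordinal ltd)) //= pd addKn qe big1 ?addr0 // => i.
  rewrite -val_eqE /= neq_ltn => /orP[lt_id|lt_di].
    by rewrite [q`_ _]nth_default ?mulr0 //; apply: leq_trans sq _; lia.
  by rewrite [p`_ _]nth_default ?mul0r //; apply: leq_trans sp _.
have topX p c m : top p 1%N c -> top (p ^+ m) m (c ^+ m).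
  move=> pd; elim: m => [|m IHm]; first by rewrite !expr0; apply: topC.
  by rewrite !exprS -add1n; apply: (topM).
have topL i : top (b i *: 'X + (x i)%:P) 1%N (b i).
  split; last by rewrite coefD coefZ coefX coefC mulr1 addr0.
  apply: leq_trans (size_polyD _ _) _; rewrite geq_max.
  rewrite (leq_trans (size_scale_leq _ _)) ?size_polyX //.
  by rewrite (leq_trans (size_polyC_leq1 _)).
rewrite -/(top _ _ _) /ext_line_poly /mmap !big_seq.
elim/big_rec2: _ => [|m p c Pm [szc ck]].
  by split; rewrite ?size_poly0 ?coef0.
have [szm mk] : top ((f P@_m)%:P * mmap1 (fun i => b i *: 'X + (x i)%:P) m) k
    (f P@_m * mmap1 b m).
  have /= km := dhomogP _ _ _ P_homog _ Pm.
  rewrite -[k]add0n; apply: (topM); first exact: topC.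
  rewrite -km mdegE /mmap1.
  apply: (big_rec3 (fun c d p => top p d c)); first exact: topC.
  move=> i c1 d1 p1 _ top1.
  by apply: (topM) => //; apply: topX.
split; last by rewrite coefD mk ck.
by apply: leq_trans (size_polyD _ _) _; rewrite geq_max szm.
Qed.


Lemma mmap_scale (K : comNzRingType) (f : {rmorphism R -> K})
    (c : K) (z : 'I_n -> K) :
  mmap f (fun i => c * z i) P = c ^+ k * mmap f z P.
Proof.
rewrite /mmap mulr_sumr !big_seq; apply: eq_bigr => m Pm.
have /= <- := dhomogP _ _ _ P_homog _ Pm.
rewrite mulrCA; congr (_ * _); rewrite mdegE -prodrXr -big_split /=.
by apply: eq_bigr => i _; rewrite exprMn.
Qed.

Lemma ext_line_poly_factor (K : closedFieldType) (f : {rmorphism R -> K})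
    (b x : 'I_n -> K) : mmap f b P != 0 ->
  exists r : 'I_k -> K,
    ext_line_poly f b x = mmap f b P *: \prod_(i < k) ('X - (r i)%:P).
Proof.
move=> Pb; have [sz lc] := size_coef_ext_line_poly f b x.
have szE : size (ext_line_poly f b x) = k.+1.
  apply/eqP; rewrite eqn_leq sz ltnNge; apply: contra Pb => szk.
  by rewrite -lc nth_default.
have [r rE] := closed_field_poly_normal (ext_line_poly f b x).
rewrite lead_coefE szE /= lc in rE.
have sr : size r = k.
  by move: szE; rewrite rE size_scale // size_prod_XsubC => -[].
exists (fun i => r`_i); rewrite rE (big_nth 0) big_mkord; congr (_ *: _).
by rewrite sr.
Qed.

End LinePolynomials.

(** * The real-valued complex modulus *)

Section ComplexNorm.
Variable R : realType.
Implicit Types z w : R[i].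

Lemma normc_ge0 z : 0 <= normc z.
Proof. by case: z => a b; apply: sqrtr_ge0. Qed.

Lemma normc_eq0 z : (normc z == 0) = (z == 0).
Proof.
by apply/eqP/eqP => [/eq0_normc//|->]; rewrite normc0.
Qed.

Lemma normc_gt0 z : (0 < normc z) = (z != 0).
Proof. by rewrite lt0r normc_eq0 normc_ge0 andbT. Qed.

Lemma normc_triangle z w : normc (z + w) <= normc z + normc w.
Proof. exact: (@le_normcD R). Qed.

Lemma Im_le_normc z : Im z <= normc z.
Proof.
case: z => a b /=; apply: le_trans (ler_norm b) _.
by rewrite -sqrtr_sqr ler_sqrt ?addr_ge0 ?sqr_ge0 // lerDr sqr_ge0.
Qed.

Lemma normc_real (x : R) : normc x%:C = `|x|.
Proof. by rewrite /= expr0n addr0 sqrtr_sqr. Qed.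

Lemma normc_prod (I : finType) (F : I -> R[i]) :
  normc (\prod_i F i) = \prod_i normc (F i).
Proof.
by apply: (big_morph _ (@normcM R)); rewrite normc1.
Qed.

End ComplexNorm.

(** * Roots of a polynomial family and the upper half-plane *)

Section RootContinuity.
Variables (R : realType) (k : nat) (F : R -> R[i] -> R[i]) (c : R[i]) (M : R).
Hypothesis c_neq0 : c != 0.
Hypothesis F_lipschitz : forall (s s0 : R) (z : R[i]),
  0 <= s <= 1 -> 0 <= s0 <= 1 ->
  normc (F s z - F s0 z) <= M * `|s - s0| * (1 + normc z) ^+ k.
Hypothesis F_factor : forall s : R, 0 <= s <= 1 ->
  exists r : 'I_k -> R[i], forall z, F s z = c * \prod_i (z - r i).

Let M1 := `|M| + 1.
Let M1_gt0 : 0 < M1. Proof. by rewrite ltr_wpDl. Qed.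

Let F_lt (s s0 : R) (z : R[i]) (N : R) : 0 <= s <= 1 -> 0 <= s0 <= 1 ->
    `|s - s0| < N / M1 ->
  normc (F s z - F s0 z) < N * (1 + normc z) ^+ k.
Proof.
move=> s01 s001 lt_s; apply: le_lt_trans (F_lipschitz z s01 s001) _.
have w_gt0 : 0 < (1 + normc z) ^+ k by rewrite exprn_gt0 // ltr_wpDr ?normc_ge0.
rewrite ltr_pM2r //; move: lt_s; rewrite ltr_pdivlMr // mulrC.
apply: le_lt_trans.
by rewrite ler_wpM2r // /M1; have := ler_norm M; lra.
Qed.

Let root_zero (s0 : R) (r : 'I_k -> R[i]) :
    (forall z, F s0 z = c * \prod_(i < k) (z - r i)) ->
  forall i, F s0 (r i) = 0.
Proof.
by move=> rE i; rewrite rE (bigD1 i) //= subrr mul0r mulr0.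
Qed.

(** If the k roots of F s all have nonpositive imaginary part, then at a point
    z of the upper half-plane the modulus of F s is at least
    normc c * Im z ^+ k, a bound independent of s that survives as s tends
    to s0. *)
Lemma no_upper_zero_limit (s0 : R) : 0 <= s0 <= 1 ->
    (forall e : R, 0 < e -> exists2 s, 0 <= s <= 1 /\ `|s - s0| < e &
      forall z : R[i], 0 < Im z -> F s z != 0) ->
  forall z : R[i], 0 < Im z -> F s0 z != 0.
Proof.
move=> s001 lim z Imz; apply/eqP => Fz0.
have w_gt0 : 0 < (1 + normc z) ^+ k by rewrite exprn_gt0 // ltr_wpDr ?normc_ge0.
pose N := normc c * Im z ^+ k / (1 + normc z) ^+ k.
have N_gt0 : 0 < N.
  by rewrite /N divr_gt0 // mulr_gt0 ?normc_gt0 ?exprn_gt0.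
have [|s [s01 lt_s] Fs] := lim (N / M1); first by rewrite divr_gt0.
have [r rE] := F_factor s01.
have := F_lt z s01 s001 lt_s.
rewrite Fz0 subr0 divfK ?gt_eqF // ltNge => /negP; apply.
rewrite rE normcM normc_prod ler_wpM2l ?normc_ge0 //.
rewrite -[k in Im z ^+ k]card_ord -prodr_const; apply: ler_prod => i _.
rewrite ltW //=; apply: le_trans (Im_le_normc _).
have := Fs (r i); rewrite (root_zero rE) eqxx.
have -> : Im (z - r i) = Im z - Im (r i) by case: (z) (r i) => [? ?] [].
by case: (ltP 0 (Im (r i))) => [_ /(_ isT)//|Imr _]; rewrite lerBrDr gerDl.
Qed.

(** If the roots of F s0 lie strictly below the real axis, each distance
    normc (z - r i) dominates a positive multiple of 1 + normc z on the closed
    upper half-plane.  So F s0 dominates a multiple of (1 + normc z) ^+ k there,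
    which is the order of growth of the perturbation, uniformly in z. *)
Lemma no_upper_zero_open (s0 : R) : 0 <= s0 <= 1 ->
    (forall z : R[i], 0 <= Im z -> F s0 z != 0) ->
  exists2 e, 0 < e & forall s, 0 <= s <= 1 -> `|s - s0| < e ->
    forall z : R[i], 0 <= Im z -> F s z != 0.
Proof.
move=> s001 Fs0; have [r rE] := F_factor s001.
have Imr i : Im (r i) < 0.
  rewrite ltNge; apply/negP => /Fs0.
  by rewrite (root_zero rE) eqxx.
pose d i := - Im (r i) / (1 + normc (r i) - Im (r i)).
have den_gt0 i : 0 < 1 + normc (r i) - Im (r i).
  by have := normc_ge0 (r i); have := Imr i; lra.
have d_gt0 i : 0 < d i by rewrite divr_gt0 // oppr_gt0.
(* With h = - Im (r i) > 0 and D the distance from z to r i: h <= D and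
   normc z <= D + normc (r i), so h (1 + normc z) <= (1 + normc (r i) + h) D. *)
have dist z i : 0 <= Im z -> d i * (1 + normc z) <= normc (z - r i).
  move=> Imz; rewrite /d mulrAC ler_pdivrMr //.
  have h1 := normc_triangle (z - r i) (r i); rewrite subrK in h1.
  have h2 := Im_le_normc (z - r i).
  have h3 : Im (z - r i) = Im z - Im (r i) by case: (z) (r i) => [? ?] [].
  rewrite h3 in h2.
  have := Imr i; have := normc_ge0 (r i); have := normc_ge0 (z - r i).
  move: h1 h2; set p := normc z; set q := normc (r i); set t := normc (_ - _).
  set u := Im (r i); set v := Im z in Imz *.
  by move=> *; nra.
pose N := normc c * \prod_i d i.
have N_gt0 : 0 < N.
  by rewrite mulr_gt0 ?prodr_gt0 ?normc_gt0.
exists (N / M1); first by rewrite divr_gt0.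
move=> s s01 lt_s z Imz; apply/eqP => Fz0.
have := F_lt z s01 s001 lt_s; rewrite Fz0 sub0r normcN ltNge => /negP; apply.
rewrite rE normcM normc_prod /N -mulrA ler_wpM2l ?normc_ge0 //.
rewrite -[k in _ ^+ k]card_ord -prodr_const -big_split /=.
apply: ler_prod => i _; rewrite dist // andbT mulr_ge0 ?ltW //.
by rewrite ltr_wpDr ?normc_ge0.
Qed.

(** Roots cannot enter the closed upper half-plane without crossing the real
    axis: the supremum u of the parameters up to which the half-plane is free
    of zeros is itself such a parameter, by passage to the limit, and by
    openness it can only be 1. *)
Lemma no_upper_zero_deformation :
    (forall (s : R) (z : R[i]), 0 <= s <= 1 -> Im z = 0 -> F s z != 0) ->
    (forall z : R[i], 0 <= Im z -> F 0 z != 0) ->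
  forall z : R[i], 0 <= Im z -> F 1 z != 0.
Proof.
move=> Freal F0.
pose free s := forall z : R[i], 0 <= Im z -> F s z != 0.
pose E : classical_sets.set R :=
  fun s => 0 <= s <= 1 /\ forall t : R, 0 <= t <= s -> free t.
have E0 : E 0.
  rewrite /E /=; split; first by rewrite lexx ler01.
  by move=> t /le_anti <-.
have E_sup : classical_sets.has_sup E.
  by split; [exists 0 | exists 1 => s [/andP[]]].
set u := sup E.
have u_ge0 : 0 <= u by apply: sup_upper_bound.
have u_le1 : u <= 1 by apply: ge_sup; [exists 0 | move=> s [/andP[]]].
have u01 : 0 <= u <= 1 by rewrite u_ge0.
have below (t : R) : 0 <= t < u -> free t.
  move=> /andP[t0 tu]; have [|s [_ Es] ts] := @sup_adherent _ E (u - t) _ E_sup.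
    by rewrite subr_gt0.
  by apply: Es; rewrite t0 ltW // -(subKr u t).
have free_u : free u.
  have [->//|u_neq0] := eqVneq u 0.
  have u_gt0 : 0 < u by rewrite lt0r u_neq0.
  move=> z; rewrite le_eqVlt => /orP[/eqP/esym|]; first exact: Freal.
  apply: no_upper_zero_limit => // e e_gt0.
  have [t [t0 tu te]] : exists t, [/\ 0 <= t, t < u & u - t < e].
    case: (ltP e u) => eu; [exists (u - e / 2) | exists (u / 2)]; split; lra.
  exists t; last by move=> w /ltW; apply: below; rewrite t0.
  by rewrite t0 distrC ger0_norm ?subr_ge0; [split; lra | exact: ltW].
have [e e_gt0 near_u] := no_upper_zero_open u01 free_u.
suff -> : 1 = u by exact: free_u.
apply/le_anti; rewrite u_le1 andbT leNgt; apply/negP => u_lt1.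
pose v := Num.min 1 (u + e / 2).
have uv : u < v by rewrite /v lt_min u_lt1 /=; lra.
have ve : v <= u + e / 2 by rewrite /v ge_min lexx orbT.
have v1 : v <= 1 by rewrite /v ge_min lexx.
suff Ev : E v by have := sup_upper_bound E_sup Ev; rewrite leNgt uv.
split; first by rewrite v1 andbT; lra.
move=> t /andP[t0 tv]; case: (ltP t u) => tu; first by apply: below; rewrite t0.
apply: near_u; first by rewrite t0; lra.
rewrite ger0_norm; lra.
Qed.

End RootContinuity.

(** * Complex values of a real form *)

Section ComplexEvaluation.
Variables (R : realType) (n : nat).
Local Notation cvec := ('I_n -> R[i]).
Local Notation rvec := ('I_n -> R).

Definition ceval (P : {mpoly R[n]}) (z : cvec) : R[i] :=
  mmap (real_complex R) z P.

Lemma eq_ceval P (z w : cvec) : z =1 w -> ceval P z = ceval P w.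
Proof. by move=> zw; congr ceval; apply: boolp.funext. Qed.

Lemma ceval_real P (x : rvec) : ceval P (fun i => (x i)%:C) = (P.@[x])%:C.
Proof.
rewrite /ceval /meval /mmap rmorph_sum; apply: eq_bigr => m _.
rewrite rmorphM /=; congr (_ * _).
by rewrite /mmap1 rmorph_prod; apply: eq_bigr => i _; rewrite rmorphXn.
Qed.

Lemma map_line_poly P (a x : rvec) :
  map_poly (real_complex R) (line_poly P a x) =
  ext_line_poly P (real_complex R) (fun i => (a i)%:C) (fun i => (x i)%:C).
Proof.
rewrite /line_poly /ext_line_poly /mmap rmorph_sum; apply: eq_bigr => m _.
rewrite rmorphM /= map_polyC; congr (_ * _).
rewrite /mmap1 rmorph_prod; apply: eq_bigr => i _.
rewrite rmorphXn rmorphD -mul_polyC rmorphM /= !map_polyC map_polyX.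
by rewrite mul_polyC.
Qed.

Lemma horner_line_complex P (a x : rvec) (z : R[i]) :
  (map_poly (real_complex R) (line_poly P a x)).[z] =
  ceval P (fun i => z * (a i)%:C + (x i)%:C).
Proof. by rewrite map_line_poly horner_ext_line_poly. Qed.

Lemma conj_ceval P (z : cvec) :
  ceval P (fun i => (z i)^*) = (ceval P z)^*.
Proof.
rewrite /ceval /mmap rmorph_sum; apply: eq_bigr => m _.
rewrite rmorphM /= oppr0; congr (_ * _).
by rewrite /mmap1 rmorph_prod; apply: eq_bigr => i _; rewrite rmorphXn.
Qed.

Lemma ceval_factor k P (b x : cvec) : P \is k.-homog -> ceval P b != 0 ->
  exists r : 'I_k -> R[i], forall z,
    ceval P (fun i => z * b i + x i) = ceval P b * \prod_i (z - r i).
Proof.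
move=> Ph Pb; have [r rE] := ext_line_poly_factor Ph x Pb; exists r => z.
transitivity (ext_line_poly P (real_complex R) b x).[z].
  by rewrite horner_ext_line_poly.
rewrite rE hornerZ horner_prod; congr (_ * _).
by apply: eq_bigr => i _; rewrite !hornerE.
Qed.

(** The functions of s and z bounded by M (1 + normc z) ^+ d and Lipschitz in s
    with constant M (1 + normc z) ^+ d are stable under sums, and under
    products with the exponents d adding up.  Linear forms have d = 1, so a
    form of degree k has d = k. *)
Lemma ceval_lipschitz k P (c b v : cvec) : P \is k.-homog ->
  exists M : R, forall (s s0 : R) (z : R[i]), 0 <= s <= 1 -> 0 <= s0 <= 1 ->
    normc (ceval P (fun i => c i + z * b i + s%:C * v i)
           - ceval P (fun i => c i + z * b i + s0%:C * v i))
    <= M * `|s - s0| * (1 + normc z) ^+ k.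
Proof.
move=> P_homog.
pose lip d (f : R -> R[i] -> R[i]) := exists2 M : R, 0 <= M &
  forall (s s0 : R) (z : R[i]), 0 <= s <= 1 -> 0 <= s0 <= 1 ->
    normc (f s z) <= M * (1 + normc z) ^+ d /\
    normc (f s z - f s0 z) <= M * `|s - s0| * (1 + normc z) ^+ d.
have w_ge0 (z : R[i]) d : 0 <= (1 + normc z) ^+ d.
  by rewrite exprn_ge0 // addr_ge0 ?normc_ge0.
have lipC a : lip 0%N (fun _ _ => a).
  exists (normc a) => [|s s0 z _ _]; first exact: normc_ge0.
  by rewrite subrr normc0 !expr0 !mulr1 lexx mulr_ge0 ?normc_ge0.
have lipD d f g : lip d f -> lip d g -> lip d (fun s z => f s z + g s z).
  move=> [M M0 Mf] [N N0 Ng]; exists (M + N) => [|s s0 z s1 s01].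
    exact: addr_ge0.
  have [f1 f2] := Mf s s0 z s1 s01; have [g1 g2] := Ng s s0 z s1 s01.
  rewrite opprD addrACA !mulrDl; split.
    exact: le_trans (normc_triangle _ _) (lerD f1 g1).
  exact: le_trans (normc_triangle _ _) (lerD f2 g2).
have lipM d e f g : lip d f -> lip e g ->
    lip (d + e)%N (fun s z => f s z * g s z).
  move=> [M M0 Mf] [N N0 Ng]; exists (M * N + M * N) => [|s s0 z s1 s01].
    by rewrite addr_ge0 ?mulr_ge0.
  have [f1 f2] := Mf s s0 z s1 s01; have [g1 g2] := Ng s s0 z s1 s01.
  have [f3 _] := Mf s0 s z s01 s1; have [g3 _] := Ng s0 s z s01 s1.
  rewrite exprD; have p1 := ler_pM (normc_ge0 _) (normc_ge0 _) f1 g1.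
  have p2 := ler_pM (normc_ge0 _) (normc_ge0 _) f2 g1.
  have p3 := ler_pM (normc_ge0 _) (normc_ge0 _) f3 g2.
  split.
    rewrite normcM; apply: le_trans p1 _.
    rewrite mulrACA ler_wpM2r ?mulr_ge0 //.
    by rewrite lerDl mulr_ge0.
  have -> : f s z * g s z - f s0 z * g s0 z =
      (f s z - f s0 z) * g s z + f s0 z * (g s z - g s0 z) by ring.
  apply: le_trans (normc_triangle _ _) _; rewrite !normcM.
  apply: le_trans (lerD p2 p3) _; rewrite le_eqVlt; apply/orP; left.
  by apply/eqP; ring.
have lipL i : lip 1%N (fun s z => c i + z * b i + s%:C * v i).
  exists (normc (c i) + normc (b i) + normc (v i)) => [|s s0 z].
    by rewrite !addr_ge0 ?normc_ge0.
  move=> /andP[s_ge0 s_le1] /andP[s0_ge0 s0_le1]; rewrite !expr1.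
  have C0 := normc_ge0 (c i); have B0 := normc_ge0 (b i).
  have V0 := normc_ge0 (v i); have Z0 := normc_ge0 z.
  split.
    apply: le_trans (normc_triangle _ _) _.
    have h := normc_triangle (c i) (z * b i).
    rewrite normcM in h; rewrite normcM normc_real ger0_norm //.
    apply: le_trans (lerD h (lexx _)) _.
    have : s * normc (v i) <= normc (v i) by rewrite ler_piMl.
    have := mulr_ge0 C0 Z0; have := mulr_ge0 B0 Z0; have := mulr_ge0 V0 Z0; nra.
  have -> : c i + z * b i + s%:C * v i - (c i + z * b i + s0%:C * v i) =
      (s - s0)%:C * v i by rewrite rmorphB /=; ring.
  rewrite normcM normc_real mulrC mulrAC ler_wpM2r //.
  have := mulr_ge0 C0 Z0; have := mulr_ge0 V0 Z0; have := mulr_ge0 B0 Z0; nra.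
have lipX d f : lip 1%N f -> lip d (fun s z => f s z ^+ d).
  move=> lf; elim: d => [|d IHd]; first exact: (lipC 1).
  have [M M0 Mf] := lipM _ _ _ _ lf IHd.
  exists M => // s s0 z s1 s01; have := Mf s s0 z s1 s01.
  by rewrite exprD expr1 !exprS.
suff [M _ HM] :
    lip k (fun s z => ceval P (fun i => c i + z * b i + s%:C * v i)).
  by exists M => s s0 z s1 s01; case: (HM s s0 z s1 s01).
have lip_ext d f g : f =2 g -> lip d f -> lip d g.
  by move=> fg [M M0 Mf]; exists M => // s s0 z; rewrite -!fg; apply: Mf.
have lip_sum I (r : seq I) d G : (forall m, lip d (G m)) ->
    lip d (fun s z => \sum_(m <- r) G m s z).
  move=> lG; elim: r => [|m r IHr].
    by exists 0 => // s s0 z _ _; rewrite !big_nil subr0 normc0 !mul0r lexx.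
  by apply: lip_ext (lipD _ _ _ (lG m) IHr) => s z; rewrite big_cons.
have lip_prod I (r : seq I) d G : (forall i, lip (d i) (G i)) ->
    lip (\sum_(i <- r) d i)%N (fun s z => \prod_(i <- r) G i s z).
  move=> lG; elim: r => [|i r IHr].
    by rewrite big_nil; apply: lip_ext (lipC 1) => s z; rewrite big_nil.
  rewrite big_cons; apply: lip_ext (lipM _ _ _ _ (lG i) IHr) => s z.
  by rewrite big_cons.
pose G m s z : R[i] := if m \in msupp P then
  (P@_m)%:C * mmap1 (fun i => c i + z * b i + s%:C * v i) m else 0.
apply: (lip_ext _ (fun s z => \sum_(m <- msupp P) G m s z)) => [s z|].
  by rewrite /ceval /mmap !big_seq; apply: eq_bigr => m Pm; rewrite /G Pm.
apply: (lip_sum _ _ _ G) => m; rewrite /G.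
have [Pm|_] := boolP (m \in msupp P); last first.
  by exists 0 => // s s0 z _ _; rewrite subr0 normc0 !mul0r lexx.
have /= <- := dhomogP _ _ _ P_homog _ Pm; rewrite mdegE -[X in lip X]add0n.
by apply: lipM => //; apply: lip_prod => i; apply: lipX.
Qed.

End ComplexEvaluation.

(** * The hyperbolicity cone *)

Section HyperbolicityCone.
Variables (R : realType) (n k : nat) (P : {mpoly R[n]}).
Hypothesis P_homog : P \is k.-homog.
Local Notation rvec := ('I_n -> R).
Implicit Types (a x y : rvec) (t : R) (z w : R[i]).

Lemma hyp_eigenvaluesP a x (l : 'I_k -> R) : hyp_eigenvalues P a x l ->
  forall z, ceval P (fun i => z * (a i)%:C + (x i)%:C) =
    (P.@[a])%:C * \prod_i (z + (l i)%:C).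
Proof.
move=> lE z; rewrite -horner_line_complex lE -mul_polyC rmorphM rmorph_prod /=.
rewrite map_polyC hornerM hornerC horner_prod; congr (_ * _).
by apply: eq_bigr => i _; rewrite rmorphD /= map_polyX map_polyC !hornerE.
Qed.

Lemma hyp_eigenvalues_eval a x (l : 'I_k -> R) : hyp_eigenvalues P a x l ->
  forall t, P.@[fun i => t * a i + x i] = P.@[a] * \prod_i (t + l i).
Proof.
move=> lE t; apply: complexI; rewrite -ceval_real rmorphM rmorph_prod /=.
transitivity (ceval P (fun i => t%:C * (a i)%:C + (x i)%:C)).
  by apply: eq_ceval => i; rewrite rmorphD rmorphM.
rewrite (hyp_eigenvaluesP lE); congr (_ * _).
by apply: eq_bigr => i _; rewrite rmorphD.
Qed.

(** By homogeneity the factorization extends to the whole complex pencil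
    spanned by a and x, including the point z = 0 at infinity. *)
Lemma hyp_eigenvalues_pencil a x (l : 'I_k -> R) : hyp_eigenvalues P a x l ->
  forall w z, ceval P (fun i => w * (a i)%:C + z * (x i)%:C) =
    (P.@[a])%:C * \prod_i (w + z * (l i)%:C).
Proof.
move=> lE w z; have [->|z0] := eqVneq z 0.
  rewrite (eq_ceval _ (_ : _ =1 fun i => w * (a i)%:C)); last first.
    by move=> i; rewrite mul0r addr0.
  rewrite /ceval (mmap_scale P_homog) -/(ceval P _) ceval_real mulrC.
  congr (_ * _); under eq_bigr do rewrite mul0r addr0.
  by rewrite prodr_const card_ord.
rewrite (eq_ceval _ (_ : _ =1 fun i =>
    z * (w / z * (a i)%:C + (x i)%:C))); last first.
  by move=> i; rewrite mulrDr mulrA mulrCA divff // mulr1.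
rewrite /ceval (mmap_scale P_homog) -/(ceval P _) (hyp_eigenvaluesP lE) mulrCA.
congr (_ * _); rewrite -[k in z ^+ k]card_ord -prodr_const -big_split /=.
by apply: eq_bigr => i _; rewrite mulrDr mulrCA divff // mulr1.
Qed.

Lemma hyperbolic_eigenvalues a x : hyperbolic P a ->
  exists l : 'I_k -> R, hyp_eigenvalues P a x l.
Proof.
move=> [Pa Hreal]; have PaC : ceval P (fun i => (a i)%:C) != 0.
  by rewrite ceval_real fmorph_eq0 gt_eqF.
pose q := map_poly (real_complex R) (line_poly P a x).
have [r rE] := ext_line_poly_factor P_homog (fun i => (x i)%:C) PaC.
have qE : q = (P.@[a])%:C *: \prod_i ('X - (r i)%:P).
  by rewrite /q map_line_poly rE -ceval_real.
have r_real i : r i = (Re (r i))%:C.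
  rewrite RRe_real //; apply: (Hreal x).
  rewrite -/q qE rootZ ?fmorph_eq0 ?gt_eqF // (bigD1 i) //= rootM.
  by rewrite root_XsubC eqxx.
exists (fun i => - Re (r i)); apply: (map_poly_inj (real_complex R)).
rewrite -/q qE -mul_polyC -[in RHS]mul_polyC rmorphM rmorph_prod /= map_polyC.
congr (_ * _); apply: eq_bigr => i _.
by rewrite rmorphD /= map_polyX map_polyC /= rmorphN polyCN /= -r_real.
Qed.

(** The eigenvalues are the opposites of the roots, so membership in the cone
    is the absence of nonnegative roots. *)
Lemma hyp_cone_criterion a x : hyperbolic P a ->
  (forall t, 0 <= t -> P.@[fun i => t * a i + x i] != 0) -> hyp_cone k P a x.
Proof.
move=> aH nz; have [l lE] := hyperbolic_eigenvalues x aH; exists l => // i.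
rewrite ltNge -oppr_ge0; apply/negP => /nz/negP; apply.
by rewrite (hyp_eigenvalues_eval lE) (bigD1 i) //= addNr mul0r mulr0.
Qed.

Lemma hyp_cone_shift_gt0 a x t : hyperbolic P a -> hyp_cone k P a x ->
  0 <= t -> 0 < P.@[fun i => t * a i + x i].
Proof.
move=> [Pa _] [l lE l_gt0] t0; rewrite (hyp_eigenvalues_eval lE) mulr_gt0 //.
by apply: prodr_gt0 => i _; rewrite ltr_wpDl.
Qed.

Lemma hyp_cone_gt0 a x : hyperbolic P a -> hyp_cone k P a x -> 0 < P.@[x].
Proof.
move=> aH xa; have := hyp_cone_shift_gt0 aH xa (lexx 0).
by congr (0 < _); congr meval; apply: boolp.funext => i; rewrite mul0r add0r.
Qed.

Lemma hyp_cone_self a : hyperbolic P a -> hyp_cone k P a a.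
Proof.
move=> aH; apply: hyp_cone_criterion => // t t0.
rewrite (_ : (fun i => _) = (fun i => (t + 1) * a i)); last first.
  by apply: boolp.funext => i; rewrite mulrDl mul1r.
rewrite /meval (mmap_scale P_homog) mulf_neq0 //; last first.
  by case: aH => /gt_eqF ->.
by rewrite expf_neq0 // gt_eqF // ltr_wpDl.
Qed.

(** The displacement v is switched on gradually: in the family
    P (c + z b + t v) with 0 <= t <= 1 no zero z crosses the real axis. *)
Lemma ceval_deformation (c b v : 'I_n -> R[i]) : ceval P b != 0 ->
    (forall t z, 0 <= t <= 1 -> Im z = 0 ->
      ceval P (fun i => c i + z * b i + t%:C * v i) != 0) ->
    (forall z, 0 <= Im z -> ceval P (fun i => c i + z * b i) != 0) ->
  forall z, 0 <= Im z -> ceval P (fun i => c i + z * b i + v i) != 0.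
Proof.
move=> Pb Hreal H0 z Imz.
have [M HM] := ceval_lipschitz c b v P_homog.
pose F t z := ceval P (fun i => c i + z * b i + t%:C * v i).
have FE t : 0 <= t <= 1 ->
    exists r : 'I_k -> R[i], forall z, F t z = ceval P b * \prod_i (z - r i).
  move=> _; have [r rE] := ceval_factor (fun i => c i + t%:C * v i) P_homog Pb.
  by exists r => w; rewrite -rE; apply: eq_ceval => i; ring.
rewrite (eq_ceval _ (_ : _ =1 fun i => c i + z * b i + 1%:C * v i)).
  apply: (no_upper_zero_deformation Pb HM FE) => // w Imw.
  rewrite (eq_ceval _ (_ : _ =1 fun i => c i + w * b i)) ?H0 // => i.
  by rewrite rmorph0 mul0r addr0.
by move=> i; rewrite rmorph1 mul1r.
Qed.

(** Garding: P is hyperbolic in every direction x of its cone.  For t > 0 the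
    polynomial P (i t a + z x + s v) has no real root z, because P has only
    real eigenvalues with respect to a; for s = 0 its roots have negative
    imaginary part because the eigenvalues of x are positive.  Hence the
    closed upper half-plane stays free of roots up to s = 1, and letting t tend
    to 0 shows that P (z x + v) has no root above the real axis; by conjugation
    it has none below either. *)
Lemma hyperbolic_change_direction a x : hyperbolic P a -> hyp_cone k P a x ->
  hyperbolic P x.
Proof.
move=> aH xa; have Px := hyp_cone_gt0 aH xa.
have PxC : ceval P (fun i => (x i)%:C) != 0.
  by rewrite ceval_real fmorph_eq0 gt_eqF.
have [Pa _] := aH; have PaC : (P.@[a])%:C != 0 by rewrite fmorph_eq0 gt_eqF.
have [l lE l_gt0] := xa.
split=> // v.
have stable (t : R) z : 0 < t -> 0 <= Im z ->
    ceval P (fun i => (t *i) * (a i)%:C + z * (x i)%:C + (v i)%:C) != 0.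
  move=> t0; move: z; apply: ceval_deformation => // [s z s01|z Imz].
    case: z => u w /= -> {w}; rewrite complexr0.
    have [m mE] := hyperbolic_eigenvalues (fun i => u * x i + s * v i) aH.
    rewrite (eq_ceval _ (_ : _ =1 fun i =>
        (t *i) * (a i)%:C + (u * x i + s * v i)%:C)); last first.
      by move=> i; rewrite rmorphD !rmorphM addrA.
    rewrite (hyp_eigenvaluesP mE) mulf_neq0 //; apply/prodf_neq0 => i _.
    by rewrite eq_complex negb_and /= addr0 (gt_eqF t0) orbT.
  rewrite (hyp_eigenvalues_pencil lE) mulf_neq0 //; apply/prodf_neq0 => i _.
  rewrite eq_complex negb_and; apply/orP; right; case: z Imz => u w /= w0.
  rewrite mulr0 add0r gt_eqF // ltr_wpDr // mulr_ge0 // ltW //.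
have upper z : 0 < Im z -> ceval P (fun i => z * (x i)%:C + (v i)%:C) != 0.
  move=> Imz; have [M HM] := ceval_lipschitz (fun i => (v i)%:C)
    (fun i => (x i)%:C) (fun i => 'i * (a i)%:C) P_homog.
  have FE (t : R) : 0 <= t <= 1 -> exists r : 'I_k -> R[i], forall z,
      ceval P (fun i => (v i)%:C + z * (x i)%:C + t%:C * ('i * (a i)%:C))
      = ceval P (fun i => (x i)%:C) * \prod_i (z - r i).
    move=> _; have [r rE] := ceval_factor
      (fun i => (v i)%:C + t%:C * ('i * (a i)%:C)) P_homog PxC.
    by exists r => w; rewrite -rE; apply: eq_ceval => i; ring.
  have F0 := @no_upper_zero_limit _ _ _ _ _ PxC HM FE 0.
  rewrite (eq_ceval _ (_ : _ =1 fun i =>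
      (v i)%:C + z * (x i)%:C + 0%:C * ('i * (a i)%:C))); last first.
    by move=> i; rewrite rmorph0 mul0r addr0 addrC.
  apply: F0 => //; first by rewrite lexx ler01.
  move=> e e_gt0; pose s := Num.min 1 (e / 2).
  have s_gt0 : 0 < s by rewrite lt_min ltr01 divr_gt0.
  have s_le : s <= e / 2 by rewrite ge_min lexx orbT.
  have s_le1 : s <= 1 by rewrite ge_min lexx.
  exists s; first by rewrite subr0 gtr0_norm // ltW //=; split; lra.
  move=> w /ltW/(stable s w s_gt0); congr (_ != 0); apply: eq_ceval => i.
  have -> : s *i = s%:C * 'i by simpc.
  by ring.
(* Conjugation sends a root below the real axis to a root above it. *)
move=> z; rewrite rootE horner_line_complex => z0.
case: (ltgtP 0 (Im z)) => Imz.
- by have := upper z Imz; rewrite z0.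
- have : 0 < Im z^* by case: (z) Imz => ? ? /=; rewrite oppr_gt0.
  move=> /upper; rewrite (eq_ceval _ (_ : _ =1 fun i =>
      (z * (x i)%:C + (v i)%:C)^*)).
    by rewrite conj_ceval (eqP z0) conjc0 eqxx.
  by move=> i; rewrite rmorphD rmorphM /= !oppr0.
- by case: (z) Imz => u w /= <-; rewrite complex_real.
Qed.

(** The cone with respect to x contains the cone with respect to a.  Deform a
    into y along a segment, which stays in the cone of a: a root of
    P (t x + a + s (y - a)) that reached the closed right half-plane of t would
    cross the imaginary axis, and being real it would cross it at 0, where the
    value P (a + s (y - a)) is positive.  The substitution t = - i z turns the
    right half-plane into the upper one. *)
Lemma hyp_cone_change_direction a x y : hyperbolic P a ->
  hyp_cone k P a x -> hyp_cone k P a y -> hyp_cone k P x y.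
Proof.
move=> aH xa ya; have xH := hyperbolic_change_direction aH xa.
have Px := hyp_cone_gt0 aH xa.
have [l lE l_gt0] := xa; have [Pa _] := aH.
have PaC : (P.@[a])%:C != 0 by rewrite fmorph_eq0 gt_eqF.
have PxC : (P.@[x])%:C != 0 by rewrite fmorph_eq0 gt_eqF.
have stable z : 0 <= Im z -> ceval P (fun i =>
    (a i)%:C + z * (- 'i * (x i)%:C) + (y i - a i)%:C) != 0.
  move: z; apply: ceval_deformation.
  - rewrite /ceval (mmap_scale P_homog) -/(ceval P _) ceval_real mulf_neq0 //.
    by rewrite expf_neq0 // oppr_eq0 eq_complex /= oner_eq0 andbF.
  - move=> s z s01; case: z => u w /= -> {w}; rewrite complexr0.
    pose ys i := (1 - s) * a i + s * y i.
    have ys_gt0 : 0 < P.@[ys].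
      have [ly lyE ly_gt0] := ya.
      have := hyp_eigenvalues_pencil lyE (1 - s)%:C s%:C.
      rewrite (eq_ceval _ (_ : _ =1 fun i => (ys i)%:C)); last first.
        by move=> i; rewrite -!rmorphM -rmorphD.
      rewrite ceval_real.
      under eq_bigr do rewrite -rmorphM -rmorphD.
      rewrite -rmorph_prod -rmorphM => /complexI ->.
      rewrite mulr_gt0 //; apply: prodr_gt0 => i _; have := ly_gt0 i.
      by move: s01 => /andP[? ?]; nra.
    have [m mE] := hyperbolic_eigenvalues ys xH.
    have m_neq0 i : m i != 0.
      apply: contraTneq ys_gt0 => mi0.
      have := hyp_eigenvalues_eval mE 0.
      rewrite (bigD1 i) //= mi0 addr0 mul0r mulr0 => ys0.
      rewrite (_ : ys = fun i => 0 * x i + ys i) ?ys0 ?ltxx //.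
      by apply: boolp.funext => j; rewrite mul0r add0r.
    rewrite (eq_ceval _ (_ : _ =1 fun i =>
        (u%:C * - 'i) * (x i)%:C + (ys i)%:C)); last first.
      move=> i; rewrite /ys !(rmorphD, rmorphM, rmorphB, rmorphN, rmorph1) /=.
      by ring.
    rewrite (hyp_eigenvaluesP mE) mulf_neq0 //; apply/prodf_neq0 => i _.
    have -> : u%:C * - 'i + (m i)%:C = m i +i* (- u) by simpc.
    by rewrite eq_complex negb_and /= m_neq0.
  - move=> z Imz; rewrite (eq_ceval _ (_ : _ =1 fun i =>
        1 * (a i)%:C + (z * - 'i) * (x i)%:C)); last by move=> i; ring.
    rewrite (hyp_eigenvalues_pencil lE) mulf_neq0 //; apply/prodf_neq0 => i _.
    case: z Imz => u w /= w0.
    have -> : 1 + (u +i* w) * - 'i * (l i)%:C = (1 + w * l i) +i* (- u * l i).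
      by simpc.
    by rewrite eq_complex negb_and /= gt_eqF // ltr_pwDl // mulr_ge0 // ltW.
apply: hyp_cone_criterion => // t t0.
have := stable (t *i); rewrite /= => /(_ t0); apply: contraNneq => Pt.
rewrite (eq_ceval _ (_ : _ =1 fun i => (t * x i + y i)%:C)); last first.
  move=> i; rewrite !(rmorphD, rmorphM, rmorphB, rmorphN, rmorph1) /=.
  by have -> : t *i * (- 'i * (x i)%:C) = t%:C * (x i)%:C; [simpc | ring].
by rewrite ceval_real Pt rmorph0.
Qed.

(** With respect to x, the point y has positive eigenvalues m i, so the point
    (1 - s) x + s y has the positive eigenvalues 1 - s + s * m i and lies in
    the cone of x.  Since a lies in the cone of x as well, changing direction
    from x to a puts that point in the cone of a.  The values of P at the three
    points are P x times products of eigenvalues, which are compared by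
    [min_prod_le_prod_mix]. *)
Lemma hyp_cone_convex a x y (s : R) : hyperbolic P a ->
    hyp_cone k P a x -> hyp_cone k P a y -> 0 <= s <= 1 ->
  let w i := (1 - s) * x i + s * y i in
  hyp_cone k P a w /\ Num.min P.@[x] P.@[y] <= P.@[w].
Proof.
move=> aH xa ya s01 w.
have xH := hyperbolic_change_direction aH xa.
have Px := hyp_cone_gt0 aH xa.
have [m mE m_gt0] := hyp_cone_change_direction aH xa ya.
have mix (t : R) :
    P.@[fun i => t * x i + w i] = P.@[x] * \prod_i (t + 1 - s + s * m i).
  apply: complexI; rewrite -ceval_real.
  rewrite (eq_ceval _ (_ : _ =1 fun i =>
      (t + 1 - s)%:C * (x i)%:C + s%:C * (y i)%:C)); last first.
    by move=> i; rewrite -!rmorphM -rmorphD /w; congr _%:C; ring.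
  rewrite (hyp_eigenvalues_pencil mE) rmorphM rmorph_prod; congr (_ * _).
  by apply: eq_bigr => i _; rewrite -rmorphM -rmorphD.
have wx : hyp_cone k P x w.
  apply: hyp_cone_criterion => // t t0; rewrite mix mulf_neq0 ?gt_eqF //.
  apply: prodr_gt0 => i _; have := m_gt0 i.
  by move: s01 => /andP[? ?]; nra.
have ax := hyp_cone_change_direction aH xa (hyp_cone_self aH).
split.
  exact: hyp_cone_change_direction xH ax wx.
have -> : P.@[w] = P.@[x] * \prod_i (1 - s + s * m i).
  have := mix 0; rewrite (_ : (fun i => 0 * x i + w i) = w).
    by move=> ->; under eq_bigr do rewrite add0r.
  by apply: boolp.funext => i; rewrite mul0r add0r.
have -> : P.@[y] = P.@[x] * \prod_i m i.
  have := hyp_eigenvalues_eval mE 0; rewrite (_ : (fun i => 0 * x i + y i) = y).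
    by move=> ->; under eq_bigr do rewrite add0r.
  by apply: boolp.funext => i; rewrite mul0r add0r.
rewrite -[X in Num.min X _]mulr1 -minr_pMr ?(ltW Px) // ler_pM2l //.
have := @min_prod_le_prod_mix _ s (codom m) s01.
rewrite !big_image /=. apply => mu /codomP[i ->]; exact: m_gt0.
Qed.

End HyperbolicityCone.

(** * The diagonal of a symmetric matrix *)

Lemma char_poly_conj (K : fieldType) n (U D : 'M[K]_n) : U \in unitmx ->
  char_poly (invmx U *m D *m U) = char_poly D.
Proof.
move=> Uu; pose V : 'M[{poly K}]_n := map_mx polyC (invmx U).
pose W : 'M[{poly K}]_n := map_mx polyC U.
have VW : V *m W = 1%:M by rewrite -map_mxM mulVmx // map_mx1.
have -> : char_poly (invmx U *m D *m U) = \det (V *m char_poly_mx D *m W).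
  rewrite /char_poly /char_poly_mx !map_mxM mulmxBr mulmxBl -/V -/W.
  by rewrite scalar_mxC -(mulmxA _ V W) VW mulmx1.
by rewrite !det_mulmx mulrAC -det_mulmx VW det1 mul1r.
Qed.

Lemma mul_conjc_normc (R : realType) (z : R[i]) :
  z * Num.conj z = (normc z ^+ 2)%:C.
Proof. by rewrite -normCK rmorphXn. Qed.

(** Diagonalize A over the complex numbers by a unitary matrix U.  The diagonal
    entries of A are averages of its eigenvalues with the weights |U j i| ^ 2,
    and unitarity makes these weights doubly stochastic. *)
Lemma symmetric_diag_weights (R : realType) n (A : 'M[R]_n)
    (lambda : 'I_n -> R) :
    A^T = A -> eigenvalue_list A lambda ->
  exists S : 'I_n -> 'I_n -> R,
    [/\ forall i j, 0 <= S i j, forall i, \sum_j S i j = 1,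
        forall j, \sum_i S i j = 1
      & forall i, A i i = \sum_j S i j * lambda j].
Proof.
move=> A_sym AE; pose AC := map_mx (real_complex R) A.
have AC_normal : AC \is normalmx.
  apply: symmetric_normalmx; last first.
    by apply/mxOverP => i j; rewrite mxE complex_real.
  by apply/is_hermitianmxP; rewrite expr0 scale1r map_mx_id // map_trmx A_sym.
set U := spectralmx AC; set d := spectral_diag AC.
have U_unitary : U \is unitarymx by exact: spectral_unitarymx.
have U_unit : U \in unitmx by exact: spectral_unit.
have ACE : AC = invmx U *m diag_mx d *m U by apply/orthomx_spectralP.
have /unitarymxP UUt := U_unitary.
have UtU := mulmx1C UUt.
(* The spectral theorem lists the eigenvalues in an order of its own, to be
   matched with lambda by a permutation. *)
have d_perm : perm_eq [tuple (lambda j)%:C | j < n] [tuple d 0 j | j < n].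
  apply: prod_XsubC_eq; rewrite !big_tuple.
  transitivity (char_poly AC).
    rewrite -map_char_poly AE rmorph_prod; apply: eq_bigr => j _.
    by rewrite tnth_mktuple rmorphB /= map_polyX map_polyC.
  rewrite ACE char_poly_conj // char_poly_trig ?diag_mx_is_trig //.
  by apply: eq_bigr => j _; rewrite tnth_mktuple mxE eqxx mulr1n.
have /tuple_permP[sigma sigmaE] := d_perm.
have dE j : d 0 (sigma j) = (lambda j)%:C.
  have := congr1 (fun s => nth 0 s j) sigmaE.
  by rewrite -!tnth_nth /= !tnth_mktuple.
exists (fun i j => normc (U (sigma j) i) ^+ 2); split.
- by move=> i j; rewrite sqr_ge0.
- move=> i; apply: complexI; rewrite rmorph_sum rmorph1.
  have := congr1 (fun M : 'M_n => M i i) UtU; rewrite !mxE eqxx mulr1n => <-.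
  rewrite [RHS](reindex_inj (@perm_inj _ sigma)) /=; apply: eq_bigr => j _.
  by rewrite !mxE mulrC mul_conjc_normc.
- move=> j; apply: complexI; rewrite rmorph_sum rmorph1.
  have := congr1 (fun M : 'M_n => M (sigma j) (sigma j)) UUt.
  rewrite !mxE eqxx mulr1n => <-; apply: eq_bigr => i _.
  by rewrite !mxE mul_conjc_normc.
- move=> i; apply: complexI; rewrite rmorph_sum.
  have := congr1 (fun M : 'M_n => M i i) ACE; rewrite mxE => ->.
  rewrite mxE [LHS](reindex_inj (@perm_inj _ sigma)) /=; apply: eq_bigr => j _.
  rewrite invmx_unitary // mul_mx_diag !mxE dE mulrAC [RHS]rmorphM /=.
  rewrite -mul_conjc_normc.
  by congr (_ * _); rewrite mulrC.
Qed.

(** * Symmetry of the cone and conclusion *)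

Lemma hyp_cone_perm (R : realType) (n k : nat) (P : {mpoly R[n]})
    (x : 'I_n -> R) (s : 'S_n) :
    P \is k.-homog -> symmetric_poly P -> hyperbolic P (@ones R n) ->
    hyp_cone k P (@ones R n) x ->
  hyp_cone k P (@ones R n) (fun i => x (s i)).
Proof.
move=> Ph Psym P1 xcone; apply: hyp_cone_criterion => // t t0.
rewrite (Psym s (fun i => t * 1 + x i)) gt_eqF //.
exact: (hyp_cone_shift_gt0 P1 xcone).
Qed.

Theorem theorem2p12 (R : realType) (n k : nat) (P : {mpoly R[n]})
    (P_homog : P \is k.-homog)
    (P_sym : symmetric_poly P)
    (P_hyp : hyperbolic P (@ones R n))
    (A : 'M[R]_n) (A_sym : A^T = A)
    (lambda : 'I_n -> R) (lambdaE : eigenvalue_list A lambda)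
    (lambda_cone : hyp_cone k P (@ones R n) lambda) :
  hyp_cone k P (@ones R n) (diag_vec A) /\
  P.@[lambda] <= P.@[diag_vec A].
Proof.
have [S [S_ge0 Srow Scol AE]] := symmetric_diag_weights A_sym lambdaE.
pose C x := hyp_cone k P (@ones R n) x /\ P.@[lambda] <= P.@[x].
(* The factor 1^-1 is the normalization by the common row and column sum. *)
have -> : diag_vec A = fun i => 1^-1 * \sum_j S i j * lambda j.
  by apply: boolp.funext => i; rewrite invr1 mul1r -AE.
apply: (@birkhoff_convex _ _ C) => //.
- by move=> y z /boolp.funext ->.
- move=> y z t [yc yP] [zc zP] t01.
  have [wc wP] := hyp_cone_convex P_homog P_hyp yc zc t01; split=> //.
  by apply: le_trans wP; rewrite le_min yP.
- by move=> s; split; [exact: hyp_cone_perm | rewrite P_sym].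
Qed.
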